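(* For every real number $\beta<1$, the entire function $f_{2,\beta}(z)=e^{e^z}+z-\beta$ has Baker omitted value (that is, $\infty$ is a Baker omitted value of it) but does not have any Baker wandering domain.
   Context: Write $\widehat{\mathbb{C}}=\mathbb{C}\cup\{\infty\}$. An omitted value $a\in\widehat{\mathbb{C}}$ of an entire function $f:\mathbb{C}\to\widehat{\mathbb{C}}$ (i.e. $f(z)\neq a$ for all $z\in\mathbb{C}$) is called a Baker omitted value if there is a disk $D$ in $\widehat{\mathbb{C}}$ with center at $a$ such that each connected component of the boundary of $f^{-1}(D)=\{z\in\mathbb{C}: f(z)\in D\}$ is bounded; a disk centered at $\infty$ is a set $\{|z|>R\}\cup\{\infty\}$ with $R>0$. Saying that an entire function ''has Baker omitted value'' means $\infty$ is a Baker omitted value of it. The Fatou set $\mathcal{F}(f)$ of an entire function $f$ is the set of points in a neighborhood of which the iterates $\{f^n\}_{n>0}$ are defined and form a normal family; a Fatou component is a connected component of $\mathcal{F}(f)$. For a Fatou component $U$, $U_n$ denotes the Fatou component containing $f^n(U)$. $U$ is periodic if $U_p=U$ for some $p\ge 1$, pre-periodic if it is not periodic but $U_k$ is periodic for some $k>0$, and a wandering domain if it is neither periodic nor pre-periodic. A wandering domain $W$ is a Baker wandering domain if each $W_n$ is bounded, there is a natural number $N$ such that $W_{n+1}$ surrounds $W_n$ and $0$ for all $n\ge N$, and $\mathrm{dist}(W_n,0)\to\infty$ as $n\to\infty$. Here $W_{n+1}$ surrounds $W_n$ (or $0$) if a bounded component of $\widehat{\mathbb{C}}\setminus W_{n+1}$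 contains $W_n$ (or $0$), and $\mathrm{dist}$ is Euclidean distance. *)

(* Defs.v *)
From HB Require Import structures.
From mathcomp Require Import all_boot all_order all_algebra.
From mathcomp Require Import all_classical all_reals all_analysis.
From mathcomp Require Import complex.

Set Implicit Arguments.
Unset Strict Implicit.
Unset Printing Implicit Defensive.

Import Order.TTheory GRing.Theory Num.Theory.
Import numFieldNormedType.Exports.

Local Open Scope classical_set_scope.
Local Open Scope ring_scope.
Local Open Scope complex_scope.

(* The complex plane. [R[i]] itself carries no topology in the libraries;
   packaging it as a [numClosedFieldType] gives it the one of its norm. *)
Definition Cplane (R : realType) : numClosedFieldType := R[i].

(* The Riemann sphere: [None] is the point at infinity. *)
Definition sphere (R : realType) : topologicalType :=
  one_point_compactification (Cplane R).

Section Plane.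
Context {R : realType}.
Local Notation C := (Cplane R).
Local Notation Chat := (sphere R).

(* The norm of [C] takes its values in [C]; this is the real-valued modulus. *)
Definition cabs (z : C) : R := Normc.normc z.

Definition cexp (z : C) : C :=
  expR (complex.Re z) * cos (complex.Im z)
    +i* (expR (complex.Re z) * sin (complex.Im z)).

(* Complex derivability: the scalar field of the normed space [C] is [C]. *)
Definition entire (f : C -> C) : Prop := forall z : C, derivable f z 1.

Definition toSphere (z : C) : Chat := Some z.

Definition disk (a : Chat) (r : R) : set Chat :=
  if a is Some c then toSphere @` [set z | cabs (z - c) < r]
  else toSphere @` [set z | r < cabs z] `|` [set None].

Definition is_component (T : topologicalType) (A B : set T) : Prop :=
  exists2 x, A x & B = connected_component A x.

Definition boundary (T : topologicalType) (A : set T) : set T :=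
  closure A `\` interior A.

Definition omitted_value (f : C -> C) (a : Chat) : Prop :=
  forall z, toSphere (f z) <> a.

Definition Baker_omitted_value (f : C -> C) (a : Chat) : Prop :=
  [/\ entire f, omitted_value f a &
    exists2 r : R, 0 < r &
      forall B : set C,
        is_component (boundary ((toSphere \o f) @^-1` disk a r)) B ->
        bounded_set B].

Definition has_Baker_omitted_value (f : C -> C) : Prop :=
  Baker_omitted_value f None.

(* Chordal distance between the stereographic images on the unit sphere. *)
Definition chordal (p q : Chat) : R :=
  match p, q with
  | Some z, Some w => 2 * cabs (z - w) /
      (Num.sqrt (1 + cabs z ^+ 2) * Num.sqrt (1 + cabs w ^+ 2))
  | Some z, None | None, Some z => 2 / Num.sqrt (1 + cabs z ^+ 2)
  | None, None => 0
  end.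

(* Normality for maps into the sphere: the limits may take the value infinity,
   and convergence is uniform on compact sets for the chordal distance. *)
Definition normal_on (N : set C) (F : set (C -> C)) : Prop :=
  forall u : nat -> C -> C, (forall k, F (u k)) ->
    exists2 phi : nat -> nat, {homo phi : m n / (m < n)%N} &
    exists g : C -> Chat,
      forall K : set C, compact K -> K `<=` N ->
      forall e : R, 0 < e ->
        \forall k \near \oo,
          forall z, K z -> chordal (toSphere (u (phi k) z)) (g z) < e.

Definition iterates (f : C -> C) : set (C -> C) :=
  [set h | exists2 n, (0 < n)%N & h = iter n f].

Definition Fatou_set (f : C -> C) : set C :=
  [set z | exists N : set C, [/\ open N, N z & normal_on N (iterates f)]].

Definition Fatou_component (f : C -> C) (U : set C) : Prop :=
  is_component (Fatou_set f) U.

(* [Ucomp f U n] is U_n, the Fatou component containing f^n(U). *)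
Definition Ucomp (f : C -> C) (U : set C) (n : nat) : set C :=
  xget set0 [set V | Fatou_component f V /\ iter n f @` U `<=` V].

Definition periodic (f : C -> C) (U : set C) : Prop :=
  exists2 p, (1 <= p)%N & Ucomp f U p = U.

Definition preperiodic (f : C -> C) (U : set C) : Prop :=
  ~ periodic f U /\ exists2 k, (0 < k)%N & periodic f (Ucomp f U k).

Definition wandering_domain (f : C -> C) (W : set C) : Prop :=
  [/\ Fatou_component f W, ~ periodic f W & ~ preperiodic f W].

Definition surrounds (V A : set C) : Prop :=
  exists B : set Chat,
    [/\ is_component (~` (toSphere @` V)) B,
        exists2 B0 : set C, bounded_set B0 & B = toSphere @` B0 &
        toSphere @` A `<=` B].

(* Euclidean distance to 0. *)
Definition dist0 (A : set C) : R := inf (cabs @` A).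

Definition Baker_wandering_domain (f : C -> C) (W : set C) : Prop :=
  [/\ wandering_domain f W,
      forall n, bounded_set (Ucomp f W n),
      exists N : nat, forall n, (N <= n)%N ->
        surrounds (Ucomp f W n.+1) (Ucomp f W n) /\
        surrounds (Ucomp f W n.+1) [set 0] &
      (fun n => dist0 (Ucomp f W n)) @ \oo --> +oo].

Definition f2 (beta : R) (z : C) : C := cexp (cexp z) + z - beta%:C.

End Plane.

(* Main.v *)
Require Import Defs.
From mathcomp Require Import all_boot all_order all_algebra.
From mathcomp Require Import all_classical all_reals all_analysis.
From mathcomp Require Import complex ring lra.

Set Implicit Arguments.
Unset Strict Implicit.
Unset Printing Implicit Defensive.

Import Order.TTheory GRing.Theory Num.Theory.
Import numFieldNormedType.Exports.

Local Open Scope classical_set_scope.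
Local Open Scope ring_scope.
Local Open Scope complex_scope.

(** Write z = x + i y, c = cexp z, and f = f2 beta, so that
f z = cexp c + z - beta.

Infinity is a Baker omitted value: the boundary of the set |f| > 1 lies in the
set |f| <= 1, and every connected subset K of the latter is bounded.  On a
line y = k pi the imaginary part of f z is y, so K cannot cross such a line far
from the real axis and lies in a horizontal strip.  It lies in a right
half-plane because cexp c is bounded where x <= 0.  When x is large and Im c is
a multiple of 2 pi, cexp c is positive and |f z| > 1; hence K cannot pass from
|Im c| < 2 pi m to |Im c| > 2 pi m.  But |f z| <= 1 forces |cexp c| to be
comparable with |z|, so Re c is of logarithmic size while |c| = exp x; a large x
would make |Im c| large, and x is bounded on K
([sublevel_component_bounded]).

There is no Baker wandering domain because a half-line x + i pi, x > s,
consists of points of the Fatou set.  For large n the component U_n surrounds 0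
and is far from 0, so it meets that half-line, hence contains it, and cannot be
bounded ([no_Baker_wandering]).  The line Im z = pi is invariant, and f acts on
it by h x = x + exp (- exp x) - beta.  Three cases show that the half-line is
in the Fatou set:
- beta < 0: f is close to the translation by - beta on a right half-strip around
  the line, and orbits in it tend to infinity ([halfline_Fatou_neg]);
- beta = 0: in the coordinate zeta = - cexp z the map is
  zeta |-> zeta exp (exp (- zeta)), a parabolic dynamics at infinity under which
  the half-strip Re zeta >= 8, |Im zeta| <= 1 is invariant and Re zeta tends to
  infinity ([parabolic_step], [halfline_Fatou_zero]);
- 0 < beta < 1: h has the fixed point xi with exp (- exp xi) = beta, the
  multiplier of f at xi + i pi is 1 - beta exp xi, which lies in ]0, 1[, and the
  half-line x > xi is in the basin of attraction
  ([halfline_Fatou_attracting]).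

In each case the iterates converge uniformly near the point considered to a
constant of the sphere, and a sequence of iterates then has a convergent
subsequence for an elementary reason ([Fatou_of_uniform_limit]). *)

(** * Modulus and topology of the complex plane *)

Section ComplexPlane.
Context {R : realType}.
Local Notation C := (Cplane R).
Implicit Types (z w h : C) (x y : R).

Lemma normCE z : `|z| = (cabs z)%:C.
Proof. by []. Qed.

Lemma cabs_ge0 z : 0 <= cabs z.
Proof. by case: z => x y; rewrite /cabs/= sqrtr_ge0. Qed.

Lemma cabsD z w : cabs (z + w) <= cabs z + cabs w.
Proof. exact: le_normcD. Qed.

Lemma cabsM z w : cabs (z * w) = cabs z * cabs w.
Proof. exact: Normc.normcM. Qed.

Lemma cabsN z : cabs (- z) = cabs z.
Proof. exact: normcN. Qed.

Lemma cabs0 : cabs (0 : C) = 0.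
Proof. exact: Normc.normc0. Qed.

Lemma cabs_real x : cabs (x%:C : C) = `|x|.
Proof. by rewrite /cabs/= expr0n addr0 sqrtr_sqr. Qed.

Lemma normRe_le_cabs z : `|complex.Re z| <= cabs z.
Proof.
by case: z => x y; rewrite /cabs/= -sqrtr_sqr ler_wsqrtr// lerDl sqr_ge0.
Qed.

Lemma normIm_le_cabs z : `|complex.Im z| <= cabs z.
Proof.
by case: z => x y; rewrite /cabs/= -sqrtr_sqr ler_wsqrtr// lerDr sqr_ge0.
Qed.

Lemma cabs_le z : cabs z <= `|complex.Re z| + `|complex.Im z|.
Proof.
case: z => x y; rewrite /cabs/= -[leRHS]ger0_norm ?addr_ge0//.
rewrite -sqrtr_sqr ler_wsqrtr// sqrrD !real_normK ?num_real//.
by rewrite lerD2r lerDl mulrn_wge0// mulr_ge0.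
Qed.

Lemma ReD z w : complex.Re (z + w) = complex.Re z + complex.Re w.
Proof. by case: z w => [? ?] [? ?]. Qed.

Lemma ImD z w : complex.Im (z + w) = complex.Im z + complex.Im w.
Proof. by case: z w => [? ?] [? ?]. Qed.

Lemma ReN z : complex.Re (- z) = - complex.Re z.
Proof. by case: z => [? ?]. Qed.

Lemma ImN z : complex.Im (- z) = - complex.Im z.
Proof. by case: z => [? ?]. Qed.

(** The norm of the plane has complex values, and so have the radii of its
balls; this lemma and the next ones bring its topology back to the real-valued
modulus. *)
Lemma nbhsCP z (A : set C) :
  nbhs z A <-> exists2 d : R, 0 < d & forall w, cabs (w - z) < d -> A w.
Proof.
split=> [/nbhs_ballP[e /= e0 zA]|[d d0 zA]].
  have eR : e = (complex.Re e)%:C by rewrite RRe_real// gtr0_real.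
  exists (complex.Re e); first by rewrite -ltcR -eR.
  move=> w wz; apply: zA; rewrite -ball_normE/=.
  by rewrite normCE eR ltcR -opprB cabsN.
apply/nbhs_ballP; exists (d%:C : C); first by rewrite /= ltcR.
move=> w; rewrite -ball_normE /= normCE ltcR -opprB cabsN => /zA//.
Qed.

Lemma cvgCP (T : Type) (F : set_system T) (FF : Filter F) (f : T -> C) z :
  (forall d : R, 0 < d -> \forall t \near F, cabs (f t - z) < d) ->
  f @ F --> z.
Proof.
move=> fz A /nbhsCP[d d0 dA].
by apply: filterS (fz _ d0) => t /dA.
Qed.

Lemma continuous_toR (g : C -> R) :
  (forall z w, `|g w - g z| <= cabs (w - z)) -> continuous g.
Proof.
move=> gle z; have FF : Filter (nbhs z) := nbhs_filter z.
apply/(@cvgrPdist_lt _ _ _ (nbhs z) FF) => e e0.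
apply/nbhsCP; exists e => // w wz.
by rewrite distrC (le_lt_trans (gle _ _)).
Qed.

Lemma continuous_ofR (p : R -> C) :
  (forall s t, cabs (p t - p s) <= `|t - s|) -> continuous p.
Proof.
move=> ple s; apply: cvgCP => d d0.
apply/nbhs_ballP; exists d => // t; rewrite /ball/= distrC => td.
exact: le_lt_trans (ple _ _) td.
Qed.

Lemma continuous_Re : continuous (@complex.Re R : C -> R).
Proof.
by apply: continuous_toR => z w; rewrite -ReN -ReD normRe_le_cabs.
Qed.

Lemma continuous_Im : continuous (@complex.Im R : C -> R).
Proof.
by apply: continuous_toR => z w; rewrite -ImN -ImD normIm_le_cabs.
Qed.

Lemma continuous_cabs : continuous (@cabs R : C -> R).
Proof.
apply: continuous_toR => z w; rewrite ler_norml lerBlDr; apply/andP; split.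
  by have := cabsD w (z - w); rewrite subrKC -(opprB w z) cabsN; lra.
by have := cabsD z (w - z); rewrite subrKC; lra.
Qed.

Lemma bounded_setCP (A : set C) :
  bounded_set A <-> exists M : R, forall z, A z -> cabs z <= M.
Proof.
split=> [[M [Mr AM]]|[M AM]].
  exists (complex.Re M + 1) => z Az; rewrite -lecR -normCE.
  apply: (AM ((complex.Re M + 1)%:C : C)) => //.
  by rewrite -[in ltLHS](RRe_real Mr) ltcR ltrDl.
exists (M%:C : C); split; first by apply/complex_realP; exists M.
move=> N MN z Az /=; rewrite normCE; apply: le_trans (ltW MN).
by rewrite lecR AM.
Qed.

Lemma open_Re_gt (s : R) (g : C -> C) : continuous g ->
  open [set z | s < complex.Re (g z)].
Proof.
move=> cg; apply: (@open_comp _ _ (@complex.Re R \o g) [set t | s < t]).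
  by move=> w _; apply: continuous_comp; [exact: cg|exact: continuous_Re].
exact: open_gt.
Qed.

Lemma open_Im_near (y r : R) (g : C -> C) : continuous g ->
  open [set z | `|complex.Im (g z) - y| < r].
Proof.
move=> cg; apply: (@open_comp _ _ (@complex.Im R \o g) [set t | `|t - y| < r]).
  by move=> w _; apply: continuous_comp; [exact: cg|exact: continuous_Im].
apply: (@open_comp _ _ (fun t : R => `|t - y|) [set t | t < r]).
  move=> t _; apply: cvg_norm.
  by apply: cvgB; [exact: cvg_id|exact: cvg_cst].
exact: open_lt.
Qed.

(** The way in which connectedness is used: a continuous real function on
a connected set cannot jump over a value that it avoids. *)
Lemma connected_avoid (K : set C) (g : C -> R) z0 c :
  connected K -> continuous g -> K z0 -> g z0 < c ->
  (forall z, K z -> g z != c) -> forall z, K z -> g z < c.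
Proof.
move=> cK cg Kz0 gz0 gK z Kz; rewrite ltNge; apply/negP => cgz.
have : is_interval (g @` K).
  apply/connected_intervalP/connected_continuous_connected => //.
  exact: continuous_subspaceT.
move=> /(_ (g z0) (g z) ltac:(by exists z0) ltac:(by exists z) c).
rewrite (ltW gz0) cgz => /(_ isT)[w Kw gwc].
by have := gK _ Kw; rewrite gwc eqxx.
Qed.

Lemma connected_hline (y : R) (I : interval R) :
  connected [set z : C | complex.Re z \in I /\ complex.Im z = y].
Proof.
have -> : [set z : C | complex.Re z \in I /\ complex.Im z = y] =
    (fun x => x +i* y) @` [set` I].
  apply/seteqP; split=> [[a b]/= [aI <-]|_ [x xI <-]//].
  by exists a.
apply: connected_continuous_connected;
  first exact/connected_intervalP/interval_is_interval.
apply: continuous_subspaceT; apply: continuous_ofR => s t.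
by apply: (le_trans (cabs_le _)); rewrite /= subrr normr0 addr0.
Qed.

Lemma connected_vline (x : R) (I : interval R) :
  connected [set z : C | complex.Im z \in I /\ complex.Re z = x].
Proof.
have -> : [set z : C | complex.Im z \in I /\ complex.Re z = x] =
    (fun y => x +i* y) @` [set` I].
  apply/seteqP; split=> [[a b]/= [aI <-]|_ [y yI <-]//].
  by exists b.
apply: connected_continuous_connected;
  first exact/connected_intervalP/interval_is_interval.
apply: continuous_subspaceT; apply: continuous_ofR => s t.
by apply: (le_trans (cabs_le _)); rewrite /= subrr normr0 add0r.
Qed.

End ComplexPlane.

(** * Elementary inequalities *)

Section RealInequalities.
Context {R : realType}.

Lemma expR_ge_sqr (x : R) : 0 <= x -> (1 + x / 2) ^+ 2 <= expR x.
Proof.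
move=> x0; have -> : expR x = expR (x / 2) ^+ 2 by rewrite expr2 -expRD -splitr.
by rewrite ler_pXn2r ?nnegrE ?expR_ge0 ?expR_ge1Dx//; lra.
Qed.

Lemma expR_dominates (M : R) : exists2 X, 0 <= X &
  forall x, X <= x -> 2 * (x + M) <= expR x.
Proof.
(* For x >= 16 and x >= M, 2 (x + M) <= 4 x <= (1 + x / 2)^2 <= exp x. *)
exists (Num.max 16 M); first by rewrite le_max ler0n.
move=> x; rewrite ge_max => /andP[x16 xM].
have x0 : 0 <= x by lra.
by have := expR_ge_sqr x0; nra.
Qed.

Lemma sin_pin (k : nat) : sin (pi *+ k) = 0 :> R.
Proof.
by elim: k => [|k IH]; rewrite ?mulr0n ?sin0// mulrSr sinDpi IH oppr0.
Qed.

Lemma pin_unbounded (M : R) : exists k : nat, M < pi *+ k.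
Proof.
have [k Mk] : exists k : nat, M < k%:R.
  by exists (Num.bound `|M|); exact: le_lt_trans (ler_norm _) (archi_boundP _).
exists k; apply: (lt_le_trans Mk); rewrite -[in leRHS]mulr_natr.
by rewrite ler_peMl//; apply: le_trans (pi_ge2 R); rewrite ler1n.
Qed.

Lemma sin_MVT (x : R) : 0 <= x -> exists2 c, 0 <= c <= x & sin x = cos c * x.
Proof.
rewrite le_eqVlt => /orP[/eqP<-|x0].
  by exists 0; rewrite ?lexx// sin0 mulr0.
have [|c cx E] := @MVT R sin cos 0 x x0 (fun y _ => is_derive_sin y).
  by apply: continuous_subspaceT; exact: continuous_sin.
exists c; first by move: cx; rewrite in_itv/= => /andP[/ltW-> /ltW->].
by move: E; rewrite sin0 !subr0.
Qed.

Lemma sin_le_id (x : R) : 0 <= x -> sin x <= x.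
Proof.
by move=> x0; have [c _ ->] := sin_MVT x0; rewrite ler_piMl// cos_le1.
Qed.

Lemma cos_ge_quadratic (x : R) : 0 <= x <= 1 -> 1 - x ^+ 2 / 2 <= cos x.
Proof.
move=> /andP[x0 x1]; have x2 : x = (x / 2) *+ 2 by rewrite mulr2n -splitr.
rewrite [in leRHS]x2 cos_mulr2n cos2sin2.
have h0 : 0 <= x / 2 by rewrite divr_ge0.
have s1 := sin_le_id h0.
have s0 : 0 <= sin (x / 2).
  by apply: sin_ge0_pi; have := pi_ge2 R; lra.
have : sin (x / 2) ^+ 2 <= (x / 2) ^+ 2 by rewrite ler_pXn2r.
by lra.
Qed.

Lemma sin_ge_half (x : R) : 0 <= x <= 1 -> x / 2 <= sin x.
Proof.
move=> /andP[x0 x1]; have [c /andP[c0 cx] ->] := sin_MVT x0.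
have : 1 - c ^+ 2 / 2 <= cos c by apply: cos_ge_quadratic; rewrite c0/=; lra.
by nra.
Qed.

Lemma linear_approx_real (g : R -> R) (dg : R) : is_derive (0:R) 1 g dg ->
  forall e, 0 < e -> exists2 d : R, 0 < d &
    forall x, `|x| < d -> `|g x - g 0 - dg * x| <= e * `|x|.
Proof.
move=> [gd gE] e e0.
have : h^-1 *: ((g \o shift (0:R)) (h *: 1) - g 0) @[h --> 0^'] --> dg.
  by rewrite -gE; exact: gd.
move=> /cvgrPdist_lt /(_ _ e0); rewrite near_withinE => /nbhs_ballP[d /= d0 H].
exists d => // x xd; have [->|x0] := eqVneq x 0.
  by rewrite subrr mulr0 subr0 normr0 mulr0.
have := H x; rewrite /ball/= sub0r normrN => /(_ xd x0).
rewrite addr0 /GRing.scale/= mulr1 => H1.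
have -> : g x - g 0 - dg * x = - ((dg - x^-1 * (g x - g 0)) * x).
  by field.
by rewrite normrN normrM ler_wpM2r// ltW.
Qed.

End RealInequalities.

(** * The complex exponential and the linear approximation of the map *)

Section Exponential.
Context {R : realType}.
Local Notation C := (Cplane R).
Implicit Types (z w h : C).

Lemma cexpD z w : cexp (z + w) = cexp z * cexp w.
Proof.
case: z w => [a b] [c d]; rewrite /cexp /= expRD cosD sinD.
by apply/eqP; rewrite eq_complex /=; apply/andP; split; apply/eqP; ring.
Qed.

Lemma cabs_cexp z : cabs (cexp z) = expR (complex.Re z).
Proof.
case: z => a b; rewrite /cabs /cexp /= !exprMn -mulrDr cos2Dsin2 mulr1.
by rewrite sqrtr_sqr ger0_norm// expR_ge0.
Qed.

Lemma Re2DIm2_cexp (z : C) :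
  complex.Re (cexp z) ^+ 2 + complex.Im (cexp z) ^+ 2 = expR (complex.Re z) ^+ 2.
Proof. by rewrite /cexp/= !exprMn -mulrDr cos2Dsin2 mulr1. Qed.

Lemma continuous_cexp : continuous (@cexp R).
Proof.
move=> z.
have -> : @cexp R = (fun z => expR (complex.Re z) * cos (complex.Im z)
    +i* (expR (complex.Re z) * sin (complex.Im z))) by [].
have cc (g : R -> R) : continuous g -> forall p : C -> R, continuous p ->
    continuous (g \o p).
  by move=> cg p cp t; apply: continuous_comp; [exact: cp|exact: cg].
have c1 : continuous (fun z : C => expR (complex.Re z) * cos (complex.Im z)).
  move=> t; exact: (@cvgM _ _ (nbhs t) (nbhs_filter t) _ _ _ _
    (cc _ (@continuous_expR R) _ continuous_Re t)
    (cc _ (@continuous_cos R) _ continuous_Im t)).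
have c2 : continuous (fun z : C => expR (complex.Re z) * sin (complex.Im z)).
  move=> t; exact: (@cvgM _ _ (nbhs t) (nbhs_filter t) _ _ _ _
    (cc _ (@continuous_expR R) _ continuous_Re t)
    (cc _ (@continuous_sin R) _ continuous_Im t)).
apply: (@cvgCP R _ (nbhs z) (nbhs_filter z)) => d d0.
have d20 : 0 < d / 2 by rewrite divr_gt0.
have /cvgrPdist_lt/(_ _ d20) h1 := c1 z.
have /cvgrPdist_lt/(_ _ d20) h2 := c2 z.
near=> w.
apply: (le_lt_trans (cabs_le _)) => /=.
have: `|expR (complex.Re z) * cos (complex.Im z) -
    expR (complex.Re w) * cos (complex.Im w)| < d / 2 by near: w.
have: `|expR (complex.Re z) * sin (complex.Im z) -
    expR (complex.Re w) * sin (complex.Im w)| < d / 2 by near: w.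
rewrite distrC => ?; rewrite distrC => ?; lra.
Unshelve. all: by end_near. Qed.

Lemma cexp_linear_approx (e : R) : 0 < e -> exists2 d : R, 0 < d &
  forall h, cabs h < d -> cabs (cexp h - 1 - h) <= e * cabs h.
Proof.
move=> e0; pose e1 : R := Num.min 1 (e / 8).
have e10 : 0 < e1 by rewrite lt_min ltr01 divr_gt0.
have e11 : e1 <= 1 by rewrite ge_min lexx.
have e18 : 8 * e1 <= e.
  have : e1 <= e / 8 by rewrite ge_min lexx orbT.
  lra.
have D0 : is_derive (0:R) 1 expR 1
  by have := is_derive_expR (0 : R); rewrite expR0.
have D1 : is_derive (0:R) 1 cos 0
  by have := is_derive_cos (0 : R); rewrite sin0 oppr0.
have D2 : is_derive (0:R) 1 sin 1
  by have := is_derive_sin (0 : R); rewrite cos0.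
have [d1 d10 H1] := linear_approx_real D0 e10.
have [d2 d20 H2] := linear_approx_real D1 e10.
have [d3 d30 H3] := linear_approx_real D2 e10.
exists (Num.min (Num.min d1 d2) (Num.min d3 (e1 / 2))).
  by rewrite !lt_min d10 d20 d30 divr_gt0.
move=> [a b]; rewrite !lt_min => /andP[/andP[hd1 hd2] /andP[hd3 hd4]].
have := normRe_le_cabs (a +i* b); have := normIm_le_cabs (a +i* b).
rewrite [complex.Re _]/= [complex.Im _]/= => bh ah.
have {}H1 := H1 _ (le_lt_trans ah hd1).
have {}H2 := H2 _ (le_lt_trans bh hd2).
have {}H3 := H3 _ (le_lt_trans bh hd3).
apply: (le_trans (cabs_le _)).
set N := cabs (a +i* b) in ah bh hd1 hd2 hd3 hd4 *; rewrite /cexp/=.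
move: H1 H2 H3; rewrite expR0 cos0 sin0 mul0r !mul1r !subr0 => H1 H2 H3.
set X := expR a; set c := cos b; set s := sin b.
set A := `|a|; set B := `|b|.
have A0 : 0 <= A := normr_ge0 a. have B0 : 0 <= B := normr_ge0 b.
rewrite -/A -/B in ah bh H1 H2 H3.
have e1A : e1 * A <= A by rewrite ler_piMl.
have X1 : `|X - 1| <= e1.
  have -> : X - 1 = (X - 1 - a) + a by ring.
  apply: (le_trans (ler_normD _ _)); rewrite -/A.
  have : A <= e1 / 2 by rewrite ltW// (le_lt_trans ah).
  rewrite -/X in H1; lra.
have XX : `|X| <= 2.
  have -> : X = (X - 1) + 1 by ring.
  by apply: (le_trans (ler_normD _ _)); rewrite normr1; lra.
have -> : X * c - 1 - a = (X - 1 - a) + X * (c - 1) by ring.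
have -> : X * s - b = X * (s - b) + (X - 1) * b by ring.
have L1 := ler_normD (X - 1 - a) (X * (c - 1)).
have L2 := ler_normD (X * (s - b)) ((X - 1) * b).
rewrite !normrM -/B in L1 L2.
have M1 : `|X| * `|c - 1| <= 2 * (e1 * B) by rewrite ler_pM.
have M2 : `|X| * `|s - b| <= 2 * (e1 * B) by rewrite ler_pM.
have M3 : `|X - 1| * B <= e1 * B by rewrite ler_wpM2r.
have M4 : e1 * A <= e1 * N by rewrite ler_pM2l.
have M5 : e1 * B <= e1 * N by rewrite ler_pM2l.
have M6 : 8 * e1 * N <= e * N.
  by rewrite ler_wpM2r// cabs_ge0.
have M7 : 0 <= e1 * A by rewrite mulr_ge0// ltW.
rewrite -/X -/c -/s in H1 H2 H3; lra.
Qed.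

(** The epsilon form of differentiability, with derivative
1 + cexp z * cexp (cexp z).  The functional equation of cexp reduces it to the
expansion at 0: with E = cexp h - 1, f2 (z + h) - f2 z - h is
cexp (cexp z) * (cexp (cexp z * E) - 1).  The estimate also gives the
contraction at an attracting fixed point. *)
Lemma f2_linear_approx (beta : R) z (e : R) : 0 < e -> exists2 d : R, 0 < d &
  forall h, cabs h < d ->
    cabs (f2 beta (z + h) - f2 beta z - (1 + cexp z * cexp (cexp z)) * h)
      <= e * cabs h.
Proof.
move=> e0; set w0 := cexp z; set w1 := cexp w0.
pose m := cabs w1 * cabs w0.
have m0 : 0 <= m by rewrite mulr_ge0 ?cabs_ge0.
pose e1 : R := Num.min 1 (e / (3 * (m + 1))).
have e10 : 0 < e1 by rewrite lt_min ltr01 divr_gt0//; lra.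
have e11 : e1 <= 1 by rewrite ge_min lexx.
have e1m : 3 * e1 * m <= e.
  have : e1 <= e / (3 * (m + 1)) by rewrite ge_min lexx orbT.
  rewrite ler_pdivlMr; [nra|lra].
have [d d0 Hd] := cexp_linear_approx e10.
exists (Num.min d (d / (2 * (cabs w0 + 1)))).
  by rewrite lt_min d0 divr_gt0//; have := cabs_ge0 w0; lra.
move=> h; rewrite lt_min => /andP[hd hd'].
have Eh := Hd _ hd; set E := cexp h - 1 in Eh.
have EE : cexp h = 1 + E by rewrite subrKC.
have h0 := cabs_ge0 h; have w00 := cabs_ge0 w0; have w10 := cabs_ge0 w1.
have Eh2 : cabs E <= 2 * cabs h.
  have -> : E = (E - h) + h by rewrite subrK.
  by apply: (le_trans (cabsD _ _)); nra.
have kd : cabs (w0 * E) < d.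
  rewrite cabsM; move: hd'; rewrite ltr_pdivlMr; nra.
have Ek := Hd _ kd.
have -> : f2 beta (z + h) - f2 beta z - (1 + w0 * w1) * h =
    w1 * (cexp (w0 * E) - 1 - w0 * E) + w1 * (w0 * (E - h)).
  rewrite /f2 cexpD EE -/w0 mulrDr mulr1 cexpD -/w1.
  move: (cexp (w0 * E)) => Z; clear; ring.
apply: (le_trans (cabsD _ _)); rewrite !cabsM.
rewrite cabsM in Ek.
have T1 : cabs w1 * cabs (cexp (w0 * E) - 1 - w0 * E) <=
   cabs w1 * (e1 * (cabs w0 * (2 * cabs h))).
  by rewrite ler_wpM2l// (le_trans Ek)// ler_wpM2l ?(ltW e10)// ler_wpM2l.
have T2 : cabs w1 * (cabs w0 * cabs (E - h)) <= cabs w1 * (cabs w0 * (e1 * cabs h)).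
  by rewrite !ler_wpM2l.
have T3 : 3 * e1 * m * cabs h <= e * cabs h by rewrite ler_wpM2r.
rewrite /m in T3; lra.
Qed.

Lemma entire_f2 (beta : R) : entire (f2 beta).
Proof.
move=> z; apply/cvg_ex; exists (1 + cexp z * cexp (cexp z)).
apply: cvgCP => d d0; rewrite near_withinE; apply/nbhsCP.
have d20 : 0 < d / 2 by rewrite divr_gt0.
have [r r0 Hr] := f2_linear_approx beta z d20.
exists r => // h; rewrite subr0 => /Hr Hh h0.
set D := (1 + _) in Hh *.
have ch0 : 0 < cabs h.
  by rewrite lt_def cabs_ge0 andbT; apply: contra_neq h0; exact: Normc.eq0_normc.
rewrite /GRing.scale/= mulr1 (addrC h z).
have -> : h^-1 * (f2 beta (z + h) - f2 beta z) - D =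
    h^-1 * (f2 beta (z + h) - f2 beta z - D * h).
  by rewrite [RHS]mulrBr [D * h]mulrC mulKf.
rewrite cabsM (_ : cabs h^-1 = (cabs h)^-1); last exact: Normc.normcV.
rewrite mulrC ltr_pdivrMr//; apply: (le_lt_trans Hh).
by rewrite ltr_pM2r//; lra.
Qed.

Lemma continuous_f2 (beta : R) : continuous (f2 beta).
Proof.
move=> z; apply: (@cvgCP R _ (nbhs z) (nbhs_filter z)) => d d0.
apply/nbhsCP; have [r r0 Hr] := f2_linear_approx beta z ltr01.
set D := (1 + _) in Hr.
have D0 := cabs_ge0 D.
exists (Num.min r (d / (cabs D + 1))).
  by rewrite lt_min r0 divr_gt0//; lra.
move=> w; rewrite lt_min => /andP[/Hr]; rewrite subrKC => H.
rewrite ltr_pdivlMr; last lra; move=> H'.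
have -> : f2 beta w - f2 beta z =
  (f2 beta w - f2 beta z - D * (w - z)) + D * (w - z) by rewrite subrK.
by apply: (le_lt_trans (cabsD _ _)); rewrite cabsM; lra.
Qed.

Context (beta : R).
Local Notation f := (f2 beta).

Lemma Re_f2 (z : C) : complex.Re (f z) =
  expR (complex.Re (cexp z)) * cos (complex.Im (cexp z)) + complex.Re z - beta.
Proof. by case: z => x y. Qed.

Lemma Im_f2 (z : C) : complex.Im (f z) =
  expR (complex.Re (cexp z)) * sin (complex.Im (cexp z)) + complex.Im z.
Proof. by rewrite /f2 !ImD ImN /= oppr0 addr0. Qed.

End Exponential.

(** * Connected subsets of the sublevel set are bounded *)

Section BakerOmitted.
Context {R : realType} (beta : R).
Local Notation C := (Cplane R).
Local Notation f := (f2 beta).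

Section Component.
Context (K : set C) (cK : connected K) (fK : forall z, K z -> cabs (f z) <= 1).

Let ReK z : K z -> `|complex.Re (f z)| <= 1.
Proof. by move=> Kz; exact: le_trans (normRe_le_cabs _) (fK Kz). Qed.

Let ImK z : K z -> `|complex.Im (f z)| <= 1.
Proof. by move=> Kz; exact: le_trans (normIm_le_cabs _) (fK Kz). Qed.

(** On the lines Im z = k pi, cexp z is real and the imaginary part of f z
is that of z. *)
Lemma sublevel_Im_avoid z (k : nat) :
  K z -> 1 < pi *+ k :> R -> `|complex.Im z| != pi *+ k.
Proof.
move=> Kz k1; apply/eqP => zk; have := ImK Kz.
rewrite Im_f2 /cexp/=; suff -> : sin (complex.Im z) = 0.
  by rewrite mulr0 sin0 mulr0 add0r zk leNgt k1.
case: (ler0P (complex.Im z)) zk => _ zk; last by rewrite zk sin_pin.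
by rewrite -[complex.Im z]opprK sinN zk sin_pin oppr0.
Qed.

Lemma sublevel_Im_bounded z0 : K z0 ->
  exists c, forall z, K z -> `|complex.Im z| <= c.
Proof.
move=> Kz0; have [k kc] := pin_unbounded (Num.max 1 `|complex.Im z0|).
move: kc; rewrite gt_max => /andP[k1 kz0].
exists (pi *+ k) => z Kz; apply: ltW; move: z Kz.
apply: (connected_avoid cK _ Kz0) => //.
  move=> w; apply: continuous_comp; first exact: continuous_Im.
  exact: norm_continuous.
by move=> z Kz; exact: sublevel_Im_avoid.
Qed.

(** For x <= 0 the double exponential is at most exp 1 in modulus, so f z is
close to z - beta. *)
Lemma sublevel_Re_ge z : K z -> - (`|beta| + 6) <= complex.Re z.
Proof.
move=> Kz; rewrite leNgt; apply/negP => zb.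
have := ReK Kz; rewrite Re_f2 ler_norml => /andP[+ _].
have b0 := normr_ge0 beta; have b1 := ler_norm (- beta); rewrite normrN in b1.
have ex : expR (complex.Re z) <= 1 by rewrite expR_le1; lra.
have a1 : complex.Re (cexp z) <= 1.
  by rewrite /cexp/= (le_trans _ ex)// ler_piMr ?expR_ge0 ?cos_le1.
have ea : expR (complex.Re (cexp z)) <= expR 1 by rewrite ler_expR.
have e4 : expR 1 <= 4 :> R.
  have h : expR (1 : R) = expR (2^-1) * expR (2^-1).
    by rewrite -expRD; congr expR; field.
  have := expR_ge1Dx (- 2^-1 : R); rewrite expRN => H.
  have := expR_gt0 (2^-1 : R) => H0.
  have : expR (2^-1 : R) <= 2 by rewrite -[leLHS]invrK invf_ple ?posrE ?invr_gt0//; lra.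
  by rewrite h; nra.
have := cos_le1 (complex.Im (cexp z)).
have := expR_gt0 (complex.Re (cexp z)).
by nra.
Qed.

(** When Im (cexp z) is a multiple of 2 pi the double exponential is
positive, so Re (f z) > x - beta. *)
Lemma sublevel_Im_cexp_avoid z (k : nat) :
  K z -> beta + 1 < complex.Re z -> `|complex.Im (cexp z)| != pi *+ 2 *+ k.
Proof.
move=> Kz zb; apply/eqP => zk.
have := ReK Kz; rewrite Re_f2 ler_norml => /andP[_].
rewrite -cos_norm zk -[X in cos X]add0r (periodicn (@cosD2pi R)) cos0 mulr1.
by have := expR_gt0 (complex.Re (cexp z)); lra.
Qed.

(** Since |f z| <= 1 the double exponential has modulus between
|z| - |beta| - 1 and |z| + |beta| + 1, so Re (cexp z) is nonnegative and small
compared with |cexp z| = exp x; the imaginary part carries most of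
the modulus. *)
Lemma sublevel_Im_cexp_ge c : (forall z, K z -> `|complex.Im z| <= c) ->
  exists2 X, 0 <= X & forall z, K z -> X <= complex.Re z ->
    expR (complex.Re z) <= 2 * `|complex.Im (cexp z)|.
Proof.
move=> Kc; have [X X0 HX] := expR_dominates (`|beta| + c + 1).
exists (Num.max X (`|beta| + 2)); first by rewrite le_max X0.
move=> z Kz; rewrite ge_max => /andP[Xx bx].
set x := complex.Re z in Xx bx *; set a := complex.Re (cexp z).
have b0 := normr_ge0 beta; have b1 := ler_norm (- beta); rewrite normrN in b1.
have b2 := ler_norm beta.
have fE : cexp (cexp z) = f z - (z - beta%:C) by rewrite /f2; ring.
have aE : expR a = cabs (cexp (cexp z)) by rewrite cabs_cexp.
have zlo : x <= cabs z by apply: le_trans (normRe_le_cabs _); exact: ler_norm.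
have zhi : cabs z <= x + c.
  apply: (le_trans (cabs_le z)); rewrite lerD ?Kc// ger0_norm//; lra.
have f1 := fK Kz.
have ahi : expR a <= x + c + `|beta| + 1.
  rewrite aE fE; apply: (le_trans (cabsD _ _)); rewrite cabsN.
  have := cabsD z (- beta%:C); rewrite cabsN cabs_real; lra.
have alo : 1 <= expR a.
  have : cabs z <= cabs (f z) + cabs (- cexp (cexp z)) + cabs (beta%:C : C).
    have {1}-> : z = f z + - cexp (cexp z) + beta%:C by rewrite /f2; ring.
    apply: (le_trans (cabsD _ _)); rewrite lerD2r; exact: cabsD.
  by rewrite cabsN -aE cabs_real; lra.
have a0 : 0 <= a by rewrite leNgt -expR_lt1 -leNgt.
have ax : 2 * a <= expR x.
  by have := expR_ge1Dx a; have := HX _ Xx; lra.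
have := Re2DIm2_cexp z; rewrite -/x -/a => E.
rewrite -[leRHS]ger0_norm ?mulr_ge0// -[leLHS]ger0_norm ?expR_ge0//.
rewrite -ler_sqr ?nnegrE// !real_normK ?num_real// exprMn real_normK ?num_real//.
by have := expR_gt0 x; nra.
Qed.

(** The region x > X1, |Im (cexp z)| > B, with B > exp X1 a multiple of 2 pi,
is described by g > 0 for the function g below.  Its boundary g = 0 misses K:
on the line x = X1 one has |Im (cexp z)| <= exp X1 < B, and to its right K avoids
the level lines |Im (cexp z)| = B. *)
Lemma sublevel_Re_bounded z0 : K z0 ->
  exists M, forall z, K z -> complex.Re z <= M.
Proof.
move=> Kz0; have [c Kc] := sublevel_Im_bounded Kz0.
have [X X0 HX] := sublevel_Im_cexp_ge Kc.
pose X1 := Num.max X (`|beta| + 2).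
have [k] := pin_unbounded (Num.max (expR X1) `|complex.Im (cexp z0)|).
rewrite gt_max => /andP[kX kz0].
have kk : pi *+ k <= pi *+ 2 *+ k :> R by rewrite lerMn2r mulr2n lerDl pi_ge0 orbT.
have {}kX := lt_le_trans kX kk; have {kk}kz0 := lt_le_trans kz0 kk.
set B := pi *+ 2 *+ k in kX kz0.
(* B exceeds both exp X1 and the value at z0, so that z0 is on the near side. *)
pose g (z : C) := Num.min (complex.Re z - X1) (`|complex.Im (cexp z)| - B).
have X1b : beta + 1 < X1.
  by rewrite /X1 lt_max; apply/orP; right; have := ler_norm beta; lra.
have gK z : K z -> g z < 0.
  move: z; apply: (connected_avoid cK _ Kz0).
  - move=> z; apply: (@continuous_min _ _ (fun z : C => complex.Re z - X1)
      (fun z : C => `|complex.Im (cexp z)| - B)).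
      by apply: (@cvgB _ _ _ (nbhs z) (nbhs_filter z));
        [exact: continuous_Re|exact: cvg_cst].
    apply: (@cvgB _ _ _ (nbhs z) (nbhs_filter z)); last exact: cvg_cst.
    apply: (@cvg_norm _ _ _ (nbhs z) (nbhs_filter z)).
    apply: (@continuous_comp _ _ _ (@cexp R) (@complex.Im R)).
      exact: continuous_cexp.
    exact: continuous_Im.
  - by rewrite /g gt_min; apply/orP; right; lra.
  - move=> z Kz; rewrite /g.
    rewrite /Num.min; case: ltP => ab; apply/eqP => g0.
      have zX : complex.Re z = X1 by lra.
      have := cabs_cexp z; rewrite zX => zE.
      by have := normIm_le_cabs (cexp z); lra.
    have /eqP[] : `|complex.Im (cexp z)| != B.
      by apply: sublevel_Im_cexp_avoid => //; lra.
    by lra.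
exists (Num.max X1 (2 * B)) => z Kz; rewrite leNgt; apply/negP.
rewrite gt_max => /andP[zX1 zB].
have := gK _ Kz; rewrite /g gt_min => /orP[|]; first by lra.
have := HX _ Kz; 
have Xz : X <= complex.Re z by apply: le_trans (ltW zX1); rewrite le_max lexx.
move=> /(_ Xz).
have := expR_ge1Dx (complex.Re z).
by lra.
Qed.

Lemma sublevel_component_bounded : bounded_set K.
Proof.
apply/bounded_setCP; have [[z0 Kz0]|K0] := pselect (K !=set0); last first.
  by exists 0 => z Kz; case: K0; exists z.
have [c Kc] := sublevel_Im_bounded Kz0.
have [M KM] := sublevel_Re_bounded Kz0.
exists (Num.max M (`|beta| + 6) + c) => z Kz.
apply: (le_trans (cabs_le _)); apply: lerD; last exact: Kc.
have := KM _ Kz; have := sublevel_Re_ge Kz.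
move=> H1 H2; rewrite ler_norml lerNl !le_max H2 orTb andbT.
by apply/orP; right; lra.
Qed.

End Component.

Lemma has_Baker_omitted_value_f2 : has_Baker_omitted_value f.
Proof.
split; first exact: entire_f2; first by [].
exists 1 => // B [x xA ->]; apply: sublevel_component_bounded.
  exact: component_connected.
move=> z /connected_component_sub[_]; apply: contra_notP => /negP.
rewrite -ltNge => fz.
have oA : open [set w : C | 1 < cabs (f w)].
  apply: (@open_comp _ _ (@cabs R \o f) [set t | 1 < t]); last exact: open_gt.
  move=> w _; apply: continuous_comp; first exact: continuous_f2.
  exact: continuous_cabs.
apply: (@filterS _ (nbhs z) _ [set w : C | 1 < cabs (f w)]).
  by move=> w fw; left; exists (f w).
exact: open_nbhs_nbhs.
Qed.

End BakerOmitted.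

(** * Surrounding sets and Baker wandering domains *)

Section Sphere.
Context {R : realType}.
Local Notation C := (Cplane R).
Local Notation Chat := (sphere R).

Lemma connected_between (T : topologicalType) (A B : set T) :
  connected A -> A `<=` B -> B `<=` closure A -> connected B.
Proof.
move=> cA AB BA; apply/connectedP => E [E0 BE sE].
wlog AE : E E0 BE sE / A `<=` E false.
  move=> H; have [|AE|AE] := connected_subset sE _ cA.
  - by rewrite -BE.
  - exact: (H E).
  - apply: (H (E \o negb)) => //=; last by rewrite separatedC.
    by rewrite setUC.
have [x Ex] := E0 true; have [cl _] := sE.
have : (closure (E false) `&` E true) x.
  by split => //; apply: (closureS AE); apply: BA; rewrite BE; right.
by rewrite cl.
Qed.

(** If S avoided V, then S together with infinity would be a connected
subset of the complement of V, and the component of 0 would contain infinity. *)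
Lemma surrounds_meets (V S : set C) :
  connected S -> S 0 -> (forall K : set C, compact K -> ~ S `<=` K) ->
  surrounds V [set 0] -> exists2 z, S z & V z.
Proof.
move=> cS S0 unS [B [[x Vx BE] [B0 _ BB0] sB]].
apply: contrapT => SV.
have cS' : connected (@toSphere R @` S).
  apply: connected_continuous_connected => //; apply: continuous_subspaceT.
  exact: one_point_compactification_some_continuous.
have B0' : B (toSphere 0) by apply: sB; exists 0.
pose S' : set Chat := (@toSphere R @` S) `|` [set None].
have cS'' : connected S'.
  apply: (connected_between cS'); first by left.
  move=> p [|->]; first exact: subset_closure.
  move=> U [K [cK _] KU].
  have /existsNP[z /not_implyP[Sz Kz]] := unS _ cK.
  by exists (toSphere z); split; [exists z|apply: KU; left; exists z].
have BC : B = connected_component (~` (@toSphere R @` V)) (toSphere 0).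
  by rewrite BE; apply: same_connected_component; rewrite -BE.
have : B None.
  rewrite BC; apply: (@connected_component_max _ _ S') => //; last by right.
    by left; exists 0.
  move=> p [[z Sz <-]|->] [w Vw] //.
  by move=> [wz]; apply: SV; exists z => //; rewrite -wz.
by rewrite BB0 => -[].
Qed.

(** The set S1 U S2 is a path from 0 to infinity: a vertical segment
followed by a horizontal half-line.  A component far from 0 that surrounds 0
meets it on the part of the half-line contained in the Fatou set. *)
Lemma no_Baker_wandering (f : C -> C) (y s : R) : 0 <= y ->
  (forall x, s < x -> Fatou_set f (x +i* y)) ->
  ~ exists W : set C, Baker_wandering_domain f W.
Proof.
move=> y0 fs [W [_ bW [N sW] dW]].
have [n Nn dn] : exists2 n, (N <= n)%N & `|s| + y < dist0 (Ucomp f W n.+1).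
  move/cvgryPgt : dW => /(_ (`|s| + y)) [k _ Hk].
  exists (maxn N k); first exact: leq_maxl.
  by apply: Hk => /=; rewrite (leq_trans (leq_maxr N k)).
have [_ {}sW] := sW _ Nn.
have {bW} /bounded_setCP[M VM] := bW n.+1.
set V := Ucomp f W n.+1 in sW VM dn.
pose S1 := [set z : C | complex.Im z \in `[0, y] /\ complex.Re z = 0].
pose S2 := [set z : C | complex.Re z \in `[0, +oo[ /\ complex.Im z = y].
have [||K cK S12|q Sq Vq] := @surrounds_meets V (S1 `|` S2) _ _ _ sW.
- apply: connectedU; [|exact: connected_vline|exact: connected_hline].
  by exists (0 +i* y); split; split; rewrite //= in_itv/= ?lexx ?y0.
- by left; split; rewrite //= in_itv/= lexx.
- have : compact (@complex.Re R @` K).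
    apply: continuous_compact => //; apply: continuous_subspaceT.
    exact: continuous_Re.
  move=> /compact_bounded[A [_ HA]].
  have A1 : A < `|A| + 1 by rewrite (le_lt_trans (ler_norm _))// ltrDl.
  have K2 : K ((`|A| + 2) +i* y).
    by apply: S12; right; split; rewrite //= in_itv/= andbT addr_ge0.
  have := HA _ A1 (`|A| + 2) ltac:(by exists ((`|A| + 2) +i* y)).
  by rewrite /= [leLHS]ger0_norm ?addr_ge0//; lra.
have dq : `|s| + y < cabs q.
  apply: (lt_le_trans dn); apply: ge_inf; last by exists q.
  by exists 0 => _ [z _ <-]; exact: cabs_ge0.
have FV : Fatou_component f V.
  move: Vq; rewrite /V /Ucomp; case: xgetP => [U _ [FU _] _|_] //.
case: Sq => [[]|[]].
  rewrite in_itv/= => /andP[qi0 qiy] qr.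
  have := cabs_le q; rewrite qr normr0 add0r ger0_norm// => qy.
  by have := normr_ge0 s; lra.
rewrite in_itv/= andbT => q0 qy.
have sq : s < complex.Re q.
  have := cabs_le q; rewrite qy (ger0_norm q0) (ger0_norm y0) => H.
  by have := ler_norm s; lra.
pose T := [set z : C | complex.Re z \in `]s, +oo[ /\ complex.Im z = y].
have TV : T `<=` V.
  move: FV Vq => [w _ ->] wq; rewrite (same_connected_component wq).
  apply: connected_component_max; last exact: connected_hline.
    by split; rewrite //= in_itv/= sq.
  move=> [a b] [/=]; rewrite in_itv/= andbT => sa ->; exact: fs.
pose X := `|s| + `|M| + 1.
have TX : T (X +i* y).
  split; rewrite //= in_itv/= andbT /X.
  by have := ler_norm s; have := normr_ge0 M; lra.
have := le_trans (normRe_le_cabs _) (VM _ (TV _ TX)).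
rewrite /= ger0_norm /X ?addr_ge0//.
by have := ler_norm M; have := normr_ge0 s; lra.
Qed.

End Sphere.

(** * Uniform convergence to a constant implies normality *)

Section Normality.
Context {R : realType}.
Local Notation C := (Cplane R).
Local Notation Chat := (sphere R).

Lemma chordal_refl (p : Chat) : chordal p p = 0.
Proof. by case: p => [z|] //=; rewrite subrr cabs0 mulr0 mul0r. Qed.

Lemma chordal_fin (z w : C) :
  chordal (toSphere z) (toSphere w) <= 2 * cabs (z - w).
Proof.
rewrite /=.
have s1 (t : R) : 1 <= Num.sqrt (1 + t ^+ 2).
  by rewrite -[leLHS]sqrtr1 ler_wsqrtr// lerDl sqr_ge0.
rewrite ler_pdivrMr; last by rewrite mulr_gt0// (lt_le_trans ltr01).
rewrite ler_peMr ?mulr_ge0 ?cabs_ge0//.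
by rewrite -[leLHS]mulr1 ler_pM.
Qed.

Lemma chordal_None_lt (z : C) (e : R) : 0 < e -> 2 / e < cabs z ->
  chordal (toSphere z) None < e.
Proof.
move=> e0 ez /=.
have z0 : 0 < cabs z by apply: lt_trans ez; rewrite divr_gt0.
have sz : cabs z <= Num.sqrt (1 + cabs z ^+ 2).
  rewrite -[leLHS](ger0_norm (cabs_ge0 z)) -sqrtr_sqr ler_wsqrtr//.
  by rewrite lerDr.
rewrite ltr_pdivrMr; last exact: lt_le_trans sz.
move: ez; rewrite ltr_pdivrMr// => ez.
by apply: (lt_le_trans ez); rewrite mulrC ler_pM2l.
Qed.

(** A sequence of iterates f^(n k) either takes some exponent infinitely
often, and has a constant subsequence, or has exponents tending to infinity, and
converges itself. *)
Lemma Fatou_of_uniform_limit (f : C -> C) (N : set C) (g : Chat) :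
  open N ->
  (forall e, 0 < e -> exists K, forall k, (K <= k)%N ->
     forall z, N z -> chordal (toSphere (iter k f z)) g < e) ->
  N `<=` Fatou_set f.
Proof.
move=> oN cvf z Nz; exists N; split => // u uf.
have {uf} /choice[n nu] : forall k, exists n, u k = iter n f.
  by move=> k; have [n _ ->] := uf k; exists n.
have [[m mn]|mn] := pselect (exists m, forall K, exists2 k, (K <= k)%N & n k = m).
  have /choice[next nextP] : forall K, exists k, (K <= k)%N /\ n k = m.
    by move=> K; have [k] := mn K; exists k.
  pose phi := fix phi k := if k is k'.+1 then next (phi k').+1 else next 0%N.
  have phim k : n (phi k) = m by case: k => [|k]; exact: (nextP _).2.
  exists phi.
    apply: homo_ltn => [a b c|k]; first exact: ltn_trans.
    exact: (nextP _).1.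
  exists (fun z => toSphere (iter m f z)) => K _ _ e e0.
  by near=> k => w _; rewrite nu phim chordal_refl.
exists id => //; exists (fun=> g) => K _ KN e e0.
have [k0 Hk0] := cvf _ e0.
have : forall m, \forall k \near \oo, n k <> m.
  move=> m; apply: contrapT => H; apply: mn; exists m => k.
  apply: contrapT => H'; apply: H; exists k => // j /= kj njm.
  by apply: H'; exists j.
move=> nm.
have : forall j, \forall k \near \oo, (j <= n k)%N.
  elim=> [|j IH]; first by near=> k.
  near=> k; rewrite ltn_neqAle; apply/andP; split; last by near: k.
  by rewrite eq_sym; apply/eqP; near: k.
move=> /(_ k0); apply: filterS => k jk w Kw; rewrite nu; apply: Hk0 => //.
exact: KN.
Unshelve. all: by end_near. Qed.

Lemma Fatou_of_escape (f : C -> C) (N : set C) : open N ->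
  (forall M : R, exists K, forall k, (K <= k)%N ->
     forall z, N z -> M < complex.Re (iter k f z)) ->
  N `<=` Fatou_set f.
Proof.
move=> oN esc; apply: (@Fatou_of_uniform_limit f N None oN) => e e0.
have [K HK] := esc (2 / e); exists K => k Kk z Nz.
apply: chordal_None_lt => //; apply: lt_le_trans (normRe_le_cabs _).
by apply: lt_le_trans (ler_norm _); exact: HK.
Qed.

End Normality.

(** * The half-line Im z = pi lies in the Fatou set *)

Section HalfLine.
Context {R : realType}.
Local Notation C := (Cplane R).

Lemma f2_shift (beta : R) (z : C) (v := complex.Im z - pi)
    (a := expR (complex.Re z) * cos v) (b := expR (complex.Re z) * sin v) :
  complex.Re (f2 beta z) = complex.Re z - beta + expR (- a) * cos b /\
  complex.Im (f2 beta z) - pi = v - expR (- a) * sin b.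
Proof.
rewrite Re_f2 Im_f2 /cexp/=.
have -> : complex.Im z = v + pi by rewrite subrK.
by rewrite cosDpi sinDpi !mulrN cosN sinN -/a -/b; split; ring.
Qed.

(** With u = Re z and v = Im z - pi, a step adds at least
g = - beta / 2 to u and changes v by at most exp (- u).  These changes form a
geometric series along the orbit, so |v| + c exp (- u) does not increase for
c = 1 / (1 - exp (- g)), and the set P is invariant. *)
Lemma halfline_Fatou_neg (beta : R) : beta < 0 ->
  exists s, forall x, s < x -> Fatou_set (f2 beta) (x +i* pi).
Proof.
move=> beta0; set f := f2 beta.
pose g := - beta / 2; have g0 : 0 < g by rewrite /g; lra.
pose rho := 1 - expR (- g).
have rho0 : 0 < rho by rewrite /rho subr_gt0 expR_lt1; lra.
pose k : R := cos 1; have k0 : 0 < k := @cos1_gt0 R.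
pose c := rho^-1; have c0 : 0 < c by rewrite invr_gt0.
pose s := Num.max (4 / k) (1 / (k * g)).
have s0 : 0 < s by rewrite lt_max divr_gt0.
pose P (z : C) := s <= complex.Re z /\
  `|complex.Im z - pi| + c * expR (- complex.Re z) <= 1.
have step z : P z -> P (f z) /\ complex.Re z + g <= complex.Re (f z).
  move=> [su vc]; have [fu fv] := f2_shift beta z.
  rewrite -/f in fu fv.
  rewrite /P fu; set u := complex.Re z in su vc fu fv *.
  set v := complex.Im z - pi in vc fu fv *.
  set a := expR u * cos v in fu fv *; set b := expR u * sin v in fu fv *.
  have u0 : 0 < u := lt_le_trans s0 su.
  have e0 := expR_gt0 (- u).
  have v1 : `|v| <= 1 by have : 0 <= c * expR (- u); [rewrite mulr_ge0 ?ltW|lra].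
  have kv : k <= cos v.
    rewrite -cos_norm /k; move: v1; rewrite le_eqVlt => /orP[/eqP-> //|v1].
    have p2 := pi_ge2 R.
    by rewrite ltW// ltr_cos ?in_itv//= ?normr_ge0/=; lra.
  have ka : k * expR u <= a by rewrite mulrC ler_wpM2l ?expR_ge0.
  have eu : (1 + u / 2) ^+ 2 <= expR u by apply: expR_ge_sqr; exact: ltW.
  (* The constants in s give k exp u >= u and k exp u >= 1 / g. *)
  have [ku kg] : 4 <= u * k /\ 1 <= u * (k * g).
    move: su; rewrite ge_max (ler_pdivrMr _ _ k0) (ler_pdivrMr _ _ (mulr_gt0 k0 g0)).
    by case/andP.
  have au : u <= a.
    have H1 : k * (u * u / 4) <= k * expR u by rewrite ler_pM2l//; lra.
    have H2 : 4 * u <= u * k * u by rewrite ler_pM2r.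
    by lra.
  have ag : 1 <= a * g.
    apply: (le_trans kg); rewrite mulrA ler_pM2r//.
    by apply: le_trans ka; rewrite mulrC ler_pM2l//; have := expR_ge1Dx u; lra.
  have dg : expR (- a) <= g.
    rewrite expRN invf_ple ?posrE ?expR_gt0//.
    apply: (@le_trans _ _ a); last by have := expR_ge1Dx a; lra.
    by rewrite -[leLHS]mul1r ler_pdivrMr.
  have du : expR (- a) <= expR (- u) by rewrite ler_expR lerN2.
  have d0 := expR_gt0 (- a).
  have cb := cos_geN1 b.
  have ug : u + g <= u - beta + expR (- a) * cos b.
    by have : - g <= expR (- a) * cos b; [nra|rewrite /g; lra].
  split => //; split; first by lra.
  rewrite fv.
  have L1 := ler_normB v (expR (- a) * sin b).
  have L2 : `|expR (- a) * sin b| <= expR (- u).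
    rewrite normrM ger0_norm ?expR_ge0//.
    by apply: le_trans du; rewrite ler_piMr ?expR_ge0 ?sin_max.
  have L3 : c * expR (- (u - beta + expR (- a) * cos b)) <=
      c * (expR (- u) * expR (- g)).
    by rewrite ler_pM2l// -expRD ler_expR; lra.
  have L4 : c * (expR (- u) * expR (- g)) = c * expR (- u) - expR (- u).
    have -> : expR (- g) = 1 - rho by rewrite /rho; ring.
    by rewrite /c; field; rewrite gt_eqF.
  by lra.
have orb z : P z -> forall n, P (iter n f z) /\ s + g *+ n <= complex.Re (iter n f z).
  move=> Pz; elim => [|n [Pn IH]]; first by rewrite mulr0n addr0; case: (Pz).
  have [PS RS] := step _ Pn; split => //.
  by rewrite mulrS; move: RS; rewrite -iterS; lra.
pose t := Num.max s (2 * c); exists t => x tx.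
pose N := [set z : C | t < complex.Re z] `&`
  [set z : C | `|complex.Im z - pi| < 1 / 2].
apply: (@Fatou_of_escape R f N); last first.
  by split => //=; rewrite subrr normr0 divr_gt0.
- move=> M; have [n Mn] : exists n : nat, M < n%:R * g.
    exists (Num.bound (`|M| / g)); rewrite -ltr_pdivrMr//.
    apply: le_lt_trans (archi_boundP _); last by rewrite divr_ge0// ltW.
    by rewrite ler_pM2r ?invr_gt0// ler_norm.
  exists n => m nm z [tz vz].
  have Pz : P z.
    move: tz; rewrite /t /= gt_max => /andP[sz cz]; split; first exact: ltW.
    have z0 : 0 < complex.Re z := lt_trans s0 sz.
    have : c * expR (- complex.Re z) <= 1 / 2.
      rewrite expRN ler_pdivrMr ?expR_gt0//.
      by have := expR_ge1Dx (complex.Re z); lra.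
    by move: vz => /=; lra.
  have [_] := orb _ Pz m; apply: lt_le_trans; rewrite -mulr_natr.
  have : g * n%:R <= g * m%:R by rewrite ler_pM2l// ler_nat.
  by lra.
- apply: openI; first exact: (@open_Re_gt R t id (fun z => @cvg_id _ (nbhs z))).
  exact: (@open_Im_near R pi (1 / 2) id (fun z => @cvg_id _ (nbhs z))).
Qed.

(** For zeta = a + i b the two terms with factor m are the real and imaginary
parts of zeta * exp (exp (- zeta)).  To first order in d = exp (- a) this is
zeta + zeta exp (- zeta), whose imaginary part is b + d (b cos b - a sin b): the
factor a >= 8 makes the negative term dominate, and a d <= 1/2 prevents b from
changing sign. *)
Lemma parabolic_step_nonneg (a b : R) (d := expR (- a)) (t := d * sin b)
    (m := expR (d * cos b)) : 8 <= a -> 0 <= b <= 1 ->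
  a + 2 * d <= m * (a * cos t + b * sin t) /\
  0 <= m * (b * cos t - a * sin t) <= b.
Proof.
move=> a8 /andP[b0 b1].
have d0 : 0 < d := expR_gt0 _.
have ad : a * d <= 1 / 2.
  rewrite /d expRN ler_pdivrMr ?expR_gt0//.
  have : 0 <= a by lra. move=> /expR_ge_sqr; nra.
have d16 : d <= 1 / 16 by nra.
have sb1 : sin b <= b := sin_le_id b0.
have b01 : 0 <= b <= 1 by rewrite b0.
have sb2 := sin_ge_half b01.
have cb2 : 1 / 2 <= cos b by have := cos_ge_quadratic b01; nra.
have cb1 := cos_le1 b.
have t0 : 0 <= t by rewrite /t; nra.
have tb : t <= d * b by rewrite /t; nra.
have tb2 : d * b / 2 <= t by rewrite /t; nra.
have td : t <= d by nra.
have t01 : 0 <= t <= 1 by rewrite t0/=; lra.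
have st1 := sin_le_id t0.
have st2 := sin_ge_half t01.
have ct1 := cos_ge_quadratic t01.
have ct2 := cos_le1 t.
have m1 : 1 + d / 2 <= m.
  by have := expR_ge1Dx (d * cos b); rewrite -/m; nra.
have m2 : m <= 1 + 2 * d.
  apply: (@le_trans _ _ (expR d)); first by rewrite ler_expR; nra.
  have := expR_ge1Dx (- d); have := expRxMexpNx_1 d; have := expR_gt0 d.
  move: (expR d) (expR (- d)) => X Y X0 XY Y1.
  have : X * (1 - d) <= 1 by rewrite -XY ler_pM2l//; lra.
  have : 1 <= (1 + 2 * d) * (1 - d) by nra.
  move=> H1 H2; have := le_trans H2 H1.
  by rewrite ler_pM2r//; lra.
have m0 : 0 < m by lra.
split.
  have A1 : a * (1 - d ^+ 2 / 2) <= a * cos t + b * sin t.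
    have : 1 - d ^+ 2 / 2 <= cos t by nra.
    have : 0 <= b * sin t by rewrite mulr_ge0//; lra.
    nra.
  have A2 : (1 + d / 2) * (a * (1 - d ^+ 2 / 2)) <= m * (a * cos t + b * sin t).
    rewrite ler_pM//; first lra.
    by rewrite mulr_ge0//; nra.
  apply: le_trans A2.
  have -> : (1 + d / 2) * (a * (1 - d ^+ 2 / 2)) =
     a + a * d * (1 / 2 - d / 2 - d ^+ 2 / 4) by field.
  have : 1 / 4 <= 1 / 2 - d / 2 - d ^+ 2 / 4 by nra.
  have : 8 * d <= a * d by rewrite ler_pM2r.
  nra.
have ast : a * sin t <= b / 2 by nra.
have ct3 : 1 / 2 <= cos t by nra.
apply/andP; split; first by rewrite mulr_ge0 ?(ltW m0)//; nra.
have B1 : a * (d * b / 4) <= a * sin t by rewrite ler_wpM2l//; lra.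
have B2 : b * cos t <= b by rewrite ler_piMr.
have B3 : b * cos t - a * sin t <= b * (1 - 2 * d).
  have : 2 * d * b <= a * (d * b / 4).
    have : 0 <= d * b by rewrite mulr_ge0// ltW.
    by nra.
  by lra.
apply: (@le_trans _ _ (m * (b * (1 - 2 * d)))); first by rewrite ler_pM2l.
rewrite mulrCA ler_piMr//.
apply: (@le_trans _ _ ((1 + 2 * d) * (1 - 2 * d))); last by nra.
by rewrite ler_wpM2r//; lra.
Qed.

(** The map commutes with complex conjugation, which exchanges b and - b. *)
Lemma parabolic_step (a b : R) (d := expR (- a)) (t := d * sin b)
    (m := expR (d * cos b)) : 8 <= a -> `|b| <= 1 ->
  a + 2 * d <= m * (a * cos t + b * sin t) /\
  `|m * (b * cos t - a * sin t)| <= 1.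
Proof.
move=> a8 b1; have [b0|/ltW b0] := ler0P (- b).
  rewrite oppr_le0 in b0; rewrite ger0_norm// in b1.
  have [|A /andP[B1 B2]] := @parabolic_step_nonneg a b a8; first by rewrite b0.
  by split => //; rewrite ger0_norm// (le_trans B2).
rewrite ler0_norm in b1; last by rewrite -oppr_ge0.
have [|] := @parabolic_step_nonneg a (- b) a8; first by rewrite b0.
rewrite cosN sinN -/d !mulrN -/t sinN cosN -/m => A /andP[B1 B2].
split; first by apply: (le_trans A); lra.
by rewrite -normrN ger0_norm; [apply: le_trans b1|]; lra.
Qed.

(** While a = Re zeta stays below a level A, it increases by at least
2 exp (- A) at each step; so it exceeds A after a number of steps that does not
depend on the starting point in the half-strip.  Then
exp (Re z) = |zeta| >= A. *)
Lemma halfline_Fatou_zero : exists s : R,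
  forall x, s < x -> Fatou_set (f2 0) (x +i* pi : C).
Proof.
set f : C -> C := f2 0; exists 8 => x x8.
pose a (z : C) := - complex.Re (cexp z); pose b (z : C) := - complex.Im (cexp z).
have step z : 8 <= a z -> `|b z| <= 1 ->
    a z + 2 * expR (- a z) <= a (f z) /\ `|b (f z)| <= 1.
  move=> a8 b1; have := parabolic_step a8 b1.
  have fE : cexp (f z) = cexp (cexp (cexp z)) * cexp z.
    by rewrite /f /f2 subr0 cexpD.
  rewrite /a /b fE; move: (cexp z) => [p q].
  rewrite !opprK /cexp /= !sinN !cosN !mulrN !sinN !cosN => -[A B].
  split; first by apply: (le_trans A); rewrite le_eqVlt; apply/orP; left; apply/eqP; ring.
  by apply: le_trans B; rewrite le_eqVlt; apply/orP; left; apply/eqP; congr `|_|; ring.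
have orb (A : R) n z : 8 <= a z -> `|b z| <= 1 ->
    [/\ 8 <= a (iter n f z), `|b (iter n f z)| <= 1 &
        A <= a (iter n f z) \/ (2 * expR (- A)) *+ n <= a (iter n f z)].
  move=> a8 b1; elim: n => [|n [an bn H]].
    by split => //; right; rewrite mulr0n; apply: le_trans a8.
  have [A1 B1] := step _ an bn; rewrite iterS.
  have e0 := expR_gt0 (- a (iter n f z)).
  split => //; first by lra.
  have [An|nA] := leP A (a (iter n f z)); first by left; lra.
  have E : expR (- A) <= expR (- a (iter n f z)) by rewrite ler_expR lerN2 ltW.
  by right; rewrite mulrS; case: H => H; lra.
pose N := [set z : C | 8 < complex.Re (- cexp z)] `&`
          [set z : C | `|complex.Im (cexp z) - 0| < 1].
have cx : cexp (x +i* pi : C) = (- expR x)%:C.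
  by rewrite /cexp/= cospi sinpi mulrN1 mulr0.
apply: (@Fatou_of_escape R f N); last first.
  split; rewrite /= ?cospi ?sinpi ?mulr0 ?subr0 ?normr0// mulrN1 opprK.
  by have := expR_ge1Dx x; lra.
- move=> M; pose A := expR (M + 1).
  have A0 : 0 < 2 * expR (- A) by rewrite mulr_gt0 ?expR_gt0.
  have [n An] : exists n : nat, A < n%:R * (2 * expR (- A)).
    exists (Num.bound (A / (2 * expR (- A)))); rewrite -ltr_pdivrMr//.
    by apply: archi_boundP; rewrite divr_ge0 ?expR_ge0// ltW.
  exists n => k nk z [az bz].
  have [||ak bk H] := orb A k z.
  - by apply: ltW; rewrite /a -ReN; exact: az.
  - by rewrite /b normrN -[X in `|X|]subr0 ltW//; exact: bz.
  have {H}Ak : A <= a (iter k f z).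
    case: H => //; apply: le_trans; apply: (le_trans (ltW An)).
    by rewrite -[leRHS]mulr_natl ler_pM2r// ler_nat.
  have : A <= expR (complex.Re (iter k f z)).
    rewrite -cabs_cexp; apply: le_trans (normRe_le_cabs _).
    by apply: (le_trans Ak); rewrite -normrN ler_norm.
  by rewrite /A ler_expR; lra.
- apply: openI; last exact: (@open_Im_near R 0 1 _ (@continuous_cexp R)).
  apply: (@open_Re_gt R 8 (fun z => - cexp z)) => z.
  exact: (@cvgN _ _ _ (nbhs z) (nbhs_filter z) _ _ (@continuous_cexp R z)).
Qed.

(** The function x + exp (- exp x) is nondecreasing: its slope is
1 - t exp (- t) with t = exp x, and t exp (- t) <= exp (- 1).  In integrated
form, for increments below 1, this bound absorbs the growth exp d of t. *)
Lemma real_map_ge (xi x : R) : xi <= x ->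
  expR (- expR xi) - expR (- expR x) <= x - xi.
Proof.
move=> xx; pose d := x - xi; have d0 : 0 <= d by rewrite subr_ge0.
rewrite -/d; set t := expR xi.
have t0 : 0 < t := expR_gt0 _.
have -> : expR x = t * expR d by rewrite /t -expRD subrKC.
have E1 : expR (- t) <= 1 by rewrite expR_le1; lra.
have Y0 := expR_gt0 (- (t * expR d)).
have [d1|d1] := leP 1 d; first by lra.
have H1 : expR (- (t * expR d)) = expR (- t) * expR (- (t * (expR d - 1))).
  by rewrite -expRD; congr expR; ring.
have H2 := expR_ge1Dx (- (t * (expR d - 1))).
have H3 : expR d - 1 <= d * expR d.
  have := expR_ge1Dx (- d); have := expRxMexpNx_1 d; have := expR_gt0 d.
  by move: (expR d) (expR (- d)) => X Y; nra.
have H4 : t * expR (- t) <= expR (- 1).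
  have := expR_ge1Dx (t - 1); rewrite expRD => H.
  by rewrite expRN ler_pdivrMr ?expR_gt0// mulrC; lra.
have H5 : expR (- 1) * expR d <= 1 by rewrite -expRD expR_le1; lra.
have X1 : 0 <= expR d - 1 by have := expR_ge1Dx d; lra.
have e0 := expR_gt0 (- t).
have H6 : expR (- t) * (1 - expR (- (t * (expR d - 1)))) <=
    expR (- t) * (t * (expR d - 1)) by rewrite ler_pM2l//; lra.
have H7 : (t * expR (- t)) * (expR d - 1) <= expR (- 1) * (d * expR d).
  by apply: ler_pM => //; rewrite mulr_ge0// ltW.
have H8 : d * (expR (- 1) * expR d) <= d by rewrite ler_piMr.
rewrite H1; lra.
Qed.

Lemma halfline_Fatou_attracting (beta : R) : 0 < beta < 1 ->
  exists s, forall x, s < x -> Fatou_set (f2 beta) (x +i* pi).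
Proof.
move=> /andP[beta0 beta1]; set f := f2 beta.
pose xi := ln (- ln beta); exists xi => x xix.
have lnb : 0 < - ln beta by rewrite oppr_gt0 ln_lt0// beta0.
have Exi : expR xi = - ln beta by rewrite lnK.
have bE : expR (- expR xi) = beta by rewrite Exi opprK lnK.
pose h (y : R) := y + expR (- expR y) - beta.
have fh y : f (y +i* pi) = h y +i* pi.
  have [] := f2_shift beta (y +i* pi); rewrite -/f; move: (f _) => [p q].
  rewrite /= subrr cos0 sin0 mulr1 mulr0 cos0 sin0 mulr1 mulr0 => -> q0.
  by congr (_ +i* _); [rewrite /h; ring|lra].
pose z0 : C := xi +i* pi.
have fz0 : f z0 = z0 by rewrite /z0 fh /h bE addrK.
pose D := 1 - expR xi * beta.
have D1 : 0 < D < 1.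
  have E0 := expR_gt0 xi; apply/andP; split; last first.
    by rewrite /D gtrBl mulr_gt0.
  rewrite /D -bE expRN subr_gt0 ltr_pdivrMr ?expR_gt0// mul1r.
  by have := expR_ge1Dx (expR xi); lra.
move: D1 => /andP[D0 D1].
have DE : 1 + cexp z0 * cexp (cexp z0) = D%:C.
  have -> : cexp z0 = (- expR xi)%:C by rewrite /cexp/= cospi sinpi mulrN1 mulr0.
  have -> : cexp ((- expR xi)%:C : C) = beta%:C.
    by rewrite /cexp/= cos0 sin0 mulr1 mulr0 bE.
  by rewrite /D rmorphB rmorph1 rmorphM rmorphN mulNr.
pose e := (1 - D) / 2; have e0 : 0 < e by rewrite /e; lra.
pose q := (1 + D) / 2.
have q0 : 0 <= q by rewrite /q; lra.
have q1 : q < 1 by rewrite /q; lra.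
have [r r0 Hr] := f2_linear_approx beta z0 e0.
have contract z : cabs (z - z0) < r -> cabs (f z - z0) <= q * cabs (z - z0).
  move=> zr; have := Hr _ zr; rewrite subrKC DE -/f fz0.
  set w := z - z0 => H.
  have -> : f z - z0 = (f z - z0 - D%:C * w) + D%:C * w by rewrite subrK.
  apply: (le_trans (cabsD _ _)); rewrite cabsM cabs_real ger0_norm; last exact: ltW.
  have -> : q = e + D by rewrite /q /e; field.
  by rewrite (mulrDl e) lerD2r.
have orb z : cabs (z - z0) < r -> forall n, cabs (iter n f z - z0) <= q ^+ n * r.
  move=> zr; elim=> [|n IH]; first by rewrite expr0 mul1r ltW.
  have nr : cabs (iter n f z - z0) < r.
    elim: n {IH} => // n IH; rewrite iterS.
    apply: (le_lt_trans _ IH); apply: (le_trans (contract _ IH)).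
    by rewrite ler_piMl ?cabs_ge0 ?ltW.
  rewrite iterS exprS -mulrA; apply: (le_trans (contract _ nr)).
  by rewrite ler_wpM2l.
have h_ge y : xi <= y -> xi <= h y.
  by move=> /real_map_ge; rewrite bE /h; lra.
have fhn n y : iter n f (y +i* pi) = iter n h y +i* pi.
  by elim: n => // n IH; rewrite !iterS IH fh.
(* Above xi + r each step decreases by at least eta; no step goes below xi. *)
have [m hm] : exists m, iter m h x < xi + r.
  apply: contrapT => /forallNP Nm.
  have {}Nm n : xi + r <= iter n h x by rewrite leNgt; exact/negP.
  pose eta := beta - expR (- expR (xi + r)).
  have eta0 : 0 < eta by rewrite /eta -{1}bE subr_gt0 ltr_expR ltrN2 ltr_expR ltrDl.
  have dec n : iter n h x <= x - eta *+ n.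
    elim: n => [|n IH]; first by rewrite mulr0n subr0.
    rewrite iterS mulrS {1}/h.
    have : expR (- expR (iter n h x)) <= expR (- expR (xi + r)).
      by rewrite ler_expR lerN2 ler_expR.
    by rewrite /eta in IH *; lra.
  pose n := Num.bound ((x - xi) / eta).
  have : x - xi < n%:R * eta.
    rewrite -ltr_pdivrMr//; apply: archi_boundP.
    by rewrite divr_ge0 ?(ltW eta0)// subr_ge0 ltW.
  by have := dec n; have := Nm n; rewrite -mulr_natl; lra.
have cfm : continuous (iter m f).
  elim: m {hm} => [|m IH] z; first exact: cvg_id.
  by apply: (@continuous_comp _ _ _ (iter m f) f); [exact: IH|exact: continuous_f2].
(* The preimage under f^m of the disk on which f is a contraction. *)
pose N := [set z : C | cabs (iter m f z - z0) < r].
apply: (@Fatou_of_uniform_limit _ f N (toSphere z0)); last first.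
- rewrite /N /= fhn; apply: (le_lt_trans (cabs_le _)) => /=.
  have : xi <= iter m h x.
    by elim: m {hm cfm N} => [|m IH]; [exact: ltW|rewrite iterS; exact: h_ge].
  by rewrite subrr normr0 addr0 => H; rewrite ger0_norm ?subr_ge0//; lra.
- move=> d d0.
  have [n Hn] : exists n0, forall n, (n0 <= n)%N -> q ^+ n * r < d / 2.
    have /cvgrPdist_lt : q ^+ n @[n --> \oo] --> (0 : R).
      by apply: cvg_expr; rewrite ger0_norm.
    have dr : 0 < d / 2 / r by rewrite !divr_gt0.
    move=> /(_ _ dr)[n _ Hn]; exists n => j nj.
    have := Hn j nj; rewrite /= sub0r normrN ger0_norm ?exprn_ge0//.
    by rewrite ltr_pdivlMr.
  exists (m + n)%N => k mnk z Nz.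
  have mk : (m <= k)%N := leq_trans (leq_addr _ _) mnk.
  apply: (le_lt_trans (chordal_fin _ _)).
  rewrite -(subnK mk) iterD.
  have := orb _ Nz (k - m)%N; have := Hn (k - m)%N.
  rewrite leq_subRL// => /(_ mnk); lra.
- rewrite openE => z Nz; apply/nbhsCP.
  have /nbhsCP[d d0 Hd] : nbhs z (iter m f @^-1` [set w | cabs (w - z0) < r]).
    apply: cfm; apply/nbhsCP; exists (r - cabs (iter m f z - z0)).
      by rewrite subr_gt0.
    move=> w wz; rewrite /= -(subrK (iter m f z) w) -addrA.
    by apply: (le_lt_trans (cabsD _ _)); lra.
  by exists d.
Qed.

End HalfLine.

Theorem mainTheorem4 (R : realType) (beta : R) (hbeta : beta < 1) :
  has_Baker_omitted_value (f2 beta) /\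
  ~ exists W : set (Cplane R), Baker_wandering_domain (f2 beta) W.
Proof.
split; first exact: has_Baker_omitted_value_f2.
have [s Hs] : exists s, forall x, s < x -> Fatou_set (f2 beta) (x +i* pi).
  case: (ltgtP beta 0) => [b0|b0|->].
  - exact: halfline_Fatou_neg.
  - by apply: halfline_Fatou_attracting; rewrite b0.
  - exact: halfline_Fatou_zero.
exact: no_Baker_wandering (pi_ge0 R) Hs.
Qed.
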